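(* Let $k\ge 2$. For all $\psi,\varphi\in M_{k,1}$ the following are equivalent: (1) $\psi\le_{\mathcal R}\varphi$; (2) ${\sf ends}({\sf Im}(\psi))\subseteq{\sf ends}({\sf Im}(\varphi))$; (3) every right ideal of $A^*$ that intersects ${\sf Im}(\psi)$ also intersects ${\sf Im}(\varphi)$; (4) every monogenic right ideal of $A^*$ (i.e. of the form $wA^*$, $w\in A^*$) that intersects ${\sf Im}(\psi)$ also intersects ${\sf Im}(\varphi)$; (5) every path in the tree of $A^*$, starting at $\varepsilon$, of length $\max\{\ell({\sf imC}(\varphi)),\ell({\sf imC}(\psi))\}$, that intersects ${\sf imC}(\psi)$ also intersects ${\sf imC}(\varphi)$; (6) for every $y\in{\sf imC}(\psi)$: either ${\sf imC}(\varphi)$ contains a prefix of $y$, or the subtree of the tree of $A^*$ with root $y$ and leaf-set $yA^*\cap{\sf imC}(\varphi)$ is saturated.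
   Context: $A=\{a_1,\dots,a_k\}$ is an alphabet with $k\ge2$ letters, $A^*$ the free monoid of words over $A$, $\varepsilon$ the empty word, $A^\omega$ the set of infinite words. A right ideal of $A^*$ is a set $R\subseteq A^*$ with $RA^*\subseteq R$. A prefix code is a set of words none of which is a prefix of another element of the set; every right ideal $R$ is $PA^*$ for a unique prefix code $P$, and $R$ is finitely generated iff $P$ is finite. Two sets intersect iff their intersection is nonempty. A right ideal homomorphism is a function $\varphi:R\to A^*$ whose domain ${\sf Dom}(\varphi)=R$ is a right ideal, with $\varphi(xw)=\varphi(x)w$ for all $x\in R,\ w\in A^*$. Its image is ${\sf Im}(\varphi)$ (a right ideal), and ${\sf domC}(\varphi)$ is the prefix code generating ${\sf Dom}(\varphi)$. ${\sf riHom}(A^* )$ is the set of right ideal homomorphisms with finitely generated domain. A right ideal $R'\subseteq R$ is essential in the right ideal $R$ iff $R'$ intersects every nonempty right ideal contained in $R$. $\Phi$ is an essentially equal restriction of $\varphi$ (and $\varphi$ an essentially equal extension of $\Phi$) iff $\Phi$ is a restriction of $\varphi$ and ${\sf Dom}(\Phi)$ is essential in ${\sf Dom}(\varphi)$. Every $\varphi\in{\sf riHom}(A^* )$ has a unique maximal essentially equal extension $\max(\varphi)$. The Thompson-Higman monoid is $M_{k,1}=\{\max(\varphi):\varphi\in{\sf riHom}(A^* )\}$ with multiplication $\psi\varphi=\max(\psi\circ\varphi)$ (functions act on the left). Every $\varphi\in{\sf riHom}(A^* )$ represents the element $\max(\varphi)$. $\psi\le_{\mathcal R}\varphi$ means $\psi=\varphi\alpha$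 for some $\alpha\in M_{k,1}$. For a right ideal $R$, ${\sf ends}(R)\subseteq A^\omega$ is the set of infinite words having some (finite) prefix in $R$. Every element of $M_{k,1}$ can be represented by some $\varphi\in{\sf riHom}(A^* )$ for which $\varphi({\sf domC}(\varphi))$ is a prefix code; ${\sf imC}(\varphi)$ then denotes $\varphi({\sf domC}(\varphi))$, the prefix code generating ${\sf Im}(\varphi)$. In (5) and (6), $\varphi$ and $\psi$ are given by such representatives. For a finite set $S\subset A^*$, $\ell(S)$ is the length of a longest word in $S$ (taken to be $0$ if $S=\varnothing$). The tree of $A^*$ is the rooted $k$-ary tree with vertex set $A^*$, root $\varepsilon$, and edges $(v,va)$, $v\in A^*,a\in A$; paths are directed away from the root. The subtree with root $y$ and leaf-set $L\subseteq yA^*$ consists of the words having $y$ as a prefix and being a prefix of an element of $L$. A tree is saturated iff every non-leaf vertex has exactly $k$ children. Since the root $y$ must be a vertex, the second alternative of (6) presupposes $yA^*\cap{\sf imC}(\varphi)\ne\varnothing$. *)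

(* Defs.v *)
From mathcomp Require Import all_boot.
From mathcomp Require Import finmap.
From mathcomp Require Import all_classical.

Set Implicit Arguments.
Unset Strict Implicit.
Unset Printing Implicit Defensive.

Local Open Scope classical_set_scope.

Section Defs.
Variable A : finType.

Notation word := (seq A).
Implicit Types (R P S : set word) (x y v w : word).

Definition gen P : set word := [set x ++ w | x in P & w in [set: word]].

Definition right_ideal R := gen R `<=` R.

Definition fin_gen R := exists2 P, finite_set P & R = gen P.

Definition prefix_code P := forall x y, P x -> P y -> prefix x y -> x = y.

(* The prefix code generating R; existence and uniqueness: [codeP], [code_uniq]. *)
Definition code R : set word := xget set0 [set P | prefix_code P /\ R = gen P].

Definition intersects R S := (R `&` S) !=set0.

Definition essential R' R :=
  [/\ right_ideal R', right_ideal R, R' `<=` R &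
      forall S, right_ideal S -> S !=set0 -> S `<=` R -> intersects R' S].

Definition ends R : set (nat -> A) := [set u | exists n, R (mkseq u n)].

(* Partial functions on words; [None] means undefined. *)
Definition pfun := word -> option word.
Implicit Types (f g h m : pfun).

Definition Dom f : set word := [set x | f x <> None].
Definition Im f : set word := [set y | exists x, f x = Some y].

Definition ri_hom f := right_ideal (Dom f) /\
  forall x w y, f x = Some y -> f (x ++ w) = Some (y ++ w).

Definition riHom : set pfun := [set f | ri_hom f /\ fin_gen (Dom f)].

Definition restriction f g := forall x, Dom f x -> f x = g x.

Definition ess_ext f g :=
  [/\ ri_hom g, restriction f g & essential (Dom f) (Dom g)].

Definition max_ess_ext f g :=
  ess_ext f g /\ forall h, ess_ext f h -> restriction g h -> h = g.

(* Existence and uniqueness: [max_extP], [max_ess_ext_uniq]. *)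
Definition max_ext f : pfun := xget f (max_ess_ext f).

Definition pcomp g f : pfun := fun x => obind g (f x).

(* The Thompson-Higman monoid M_{k,1} for k = #|A|; its elements are in riHom
   ([Mk1_riHom]) and it is closed under [mulM] ([Mk1_mulM]). *)
Definition Mk1 : set pfun := max_ext @` riHom.

(* Functions act on the left: in [mulM g f], [f] is applied first. *)
Definition mulM g f := max_ext (pcomp g f).

Definition leR g f := exists2 h, Mk1 h & g = mulM f h.

Definition domC f := code (Dom f).
Definition imC f : set word := [set y | exists2 x, domC f x & f x = Some y].

(* Every [m] in [Mk1] has such a representative ([code_repr_ex]). *)
Definition code_repr m f := [/\ riHom f, max_ext f = m & prefix_code (imC f)].

(* Only used for finite S ([fset_set] is empty on infinite sets). *)
Definition ell S : nat := \max_(x <- fset_set S) size x.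

Definition edge : rel word := [rel v w | [exists a, w == rcons v a]].

Definition subtree y S : set word :=
  [set v | prefix y v /\ exists2 x, S x & prefix v x].

Definition nb_children (T : set word) v := #|[pred a | `[< T (rcons v a) >]]|.

(* A non-leaf vertex is one with at least one child in T. *)
Definition saturated (T : set word) :=
  forall v, T v -> nb_children T v <> 0 -> nb_children T v = #|A|.

Lemma right_idealP R : right_ideal R <-> forall x w, R x -> R (x ++ w).
Proof.
split=> [hR x w Rx|hR z [x Rx [w _ <-]]]; last exact: hR.
by apply: hR; exists x => //; exists w.
Qed.

Lemma right_ideal_gen P : right_ideal (gen P).
Proof.
apply/right_idealP => _ w [p Pp [u _ <-]].
by exists p => //; exists (u ++ w) => //; rewrite catA.
Qed.

Lemma code_uniq P Q : prefix_code P -> prefix_code Q -> gen P = gen Q -> P = Q.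
Proof.
suff sub P1 Q1 : prefix_code P1 -> prefix_code Q1 -> gen P1 = gen Q1 -> P1 `<=` Q1.
  by move=> hP hQ e; apply/seteqP; split; apply: sub.
move=> hP hQ e x Px.
have [q Qq [w _ qw]] : gen Q1 x.
  by rewrite -e; exists x => //; exists [::]; rewrite ?cats0.
have [p Pp [u _ pu]] : gen P1 q.
  by rewrite e; exists q => //; exists [::]; rewrite ?cats0.
have px : p = x by apply: hP => //; rewrite -qw -pu -catA prefix_prefix.
suff -> : x = q by [].
have s1 := congr1 size pu; have s2 := congr1 size qw.
rewrite !size_cat in s1 s2; rewrite px in s1.
have w0 : w = [::].
  by apply/eqP; rewrite -size_eq0 -leqn0 -(leq_add2l (size q)) s2 addn0 -s1 leq_addr.
by rewrite -qw w0 cats0.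
Qed.

Definition minimal R : set word := [set x | R x /\ forall y, R y -> prefix y x -> y = x].

Lemma minimalP R : right_ideal R -> prefix_code (minimal R) /\ R = gen (minimal R).
Proof.
move=> hR; split=> [x y [Rx _] [_ my]|]; first exact: my.
apply/seteqP; split=> [x Rx|]; last first.
  by move=> _ [x [Rx _] [w _ <-]]; move/right_idealP: hR; apply.
have exn : exists n, `[< R (take n x) >].
  by exists (size x); rewrite take_size; apply/asboolP.
case: (ex_minnP exn) => n /asboolP Rn mn.
exists (take n x); last by exists (drop n x) => //; rewrite cat_take_drop.
split=> // y Ry yp.
have e : y = take (size y) x.
  apply/esym/eqP; rewrite -prefixE.
  by apply: (prefix_trans yp); rewrite -{2}(cat_take_drop n x) prefix_prefix.
have le : n <= size y by apply: mn; apply/asboolP; rewrite -e.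
case/prefixP: yp => s es; have := congr1 size es; rewrite size_cat => ss.
suff s0 : s = [::] by rewrite es s0 cats0.
apply/eqP; rewrite -size_eq0 -leqn0 -(leq_add2l (size y)) -ss addn0.
by apply: leq_trans le; rewrite size_take_min geq_minl.
Qed.

Lemma codeP R : right_ideal R -> prefix_code (code R) /\ R = gen (code R).
Proof.
move=> hR; have h : exists P, (prefix_code P /\ R = gen P).
  by exists (minimal R); exact: minimalP.
exact: (@xgetPex _ set0 [set P | prefix_code P /\ R = gen P] h).
Qed.

Lemma codeE R : right_ideal R -> code R = minimal R.
Proof.
move=> hR; have [c1 e1] := codeP hR; have [c2 e2] := minimalP hR.
by apply: code_uniq => //; rewrite -e1 -e2.
Qed.

Lemma intersects_gen1 R w : right_ideal R -> intersects R (gen [set w]) <-> exists u, R (w ++ u).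
Proof.
move=> hR; split=> [[z [Rz [_ -> [u _ e]]]]|[u Ru]]; first by exists u; rewrite e.
by exists (w ++ u); split=> //; exists w => //; exists u.
Qed.

Lemma essentialP R' R : essential R' R <->
  [/\ right_ideal R', right_ideal R, R' `<=` R & forall x, R x -> exists w, R' (x ++ w)].
Proof.
split=> -[h1 h2 h3 h4]; split=> //.
- move=> x Rx; apply/(intersects_gen1 _ h1); apply: h4; first exact: right_ideal_gen.
    by exists x; exists x => //; exists [::] => //; rewrite cats0.
  by move=> _ [_ -> [w _ <-]]; move/right_idealP: h2; apply.
- move=> S hS [x Sx] sub; have [w Rw] := h4 _ (sub _ Sx).
  by exists (x ++ w); split=> //; move/right_idealP: hS; apply.
Qed.

Lemma DomP f x : Dom f x <-> exists y, f x = Some y.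
Proof. by rewrite /Dom /=; case: (f x) => [y|]; split=> //; [exists y|case]. Qed.

Lemma notDom f x : ~ Dom f x -> f x = None.
Proof. exact: contrapT. Qed.

Lemma ri_hom_cat f x w : ri_hom f -> Dom f x -> f (x ++ w) = omap (cat^~ w) (f x).
Proof. by move=> [_ h] /DomP[y e]; rewrite e /=; apply: h. Qed.

Lemma cat_injr x y w : x ++ w = y ++ w -> x = y.
Proof.
move=> e; have := congr1 size e; rewrite !size_cat => /addIn se.
by move/eqP: e; rewrite eqseq_cat // => /andP[/eqP].
Qed.

Lemma ess_ext_agree f g h x : ess_ext f g -> ess_ext f h ->
  Dom g x -> Dom h x -> g x = h x.
Proof.
move=> [hg rg /essentialP[_ _ _ eg]] [hh rh _] gx hx.
have [w fw] := eg _ gx.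
have := rh _ fw; rewrite (rg _ fw) (ri_hom_cat w hg gx) (ri_hom_cat w hh hx).
by case/DomP: gx hx => u -> /DomP[v ->] /= [] /cat_injr->.
Qed.

Lemma ess_ext_refl f : ri_hom f -> ess_ext f f.
Proof.
move=> hf; split=> //; apply/essentialP; split=> //; try exact: hf.1.
by move=> x fx; exists [::]; rewrite cats0.
Qed.

Lemma restriction_Dom f g : restriction f g -> Dom f `<=` Dom g.
Proof. by move=> r x fx; rewrite /Dom /= -r. Qed.

Lemma ess_ext_trans f g h : ess_ext f g -> ess_ext g h -> ess_ext f h.
Proof.
move=> [hg rg /essentialP[f1 _ _ eg]] [hh rh /essentialP[_ h1 _ eh]].
have r : restriction f h.
  by move=> x fx; rewrite rg // rh //; apply: restriction_Dom fx.
split=> //; apply/essentialP; split=> //; first exact: restriction_Dom.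
move=> x /eh[w /eg[u fu]]; exists (w ++ u); by rewrite catA.
Qed.

Definition union_ext f : pfun := fun x =>
  if pselect (exists g, ess_ext f g /\ Dom g x) is left e
  then projT1 (cid e) x else None.

Lemma union_extE f g x : ess_ext f g -> Dom g x -> union_ext f x = g x.
Proof.
move=> hg gx; rewrite /union_ext; case: pselect => [e|[]]; last by exists g.
by case: (cid e) => h /= [hh hx]; apply: ess_ext_agree hh hg hx gx.
Qed.

Lemma union_extD f x : Dom (union_ext f) x -> exists g, ess_ext f g /\ Dom g x.
Proof. by rewrite /Dom /union_ext /=; case: pselect. Qed.

Lemma union_ext_ess f : ri_hom f -> ess_ext f (union_ext f).
Proof.
move=> hf; have r g : ess_ext f g -> restriction g (union_ext f).
  by move=> hg x gx; rewrite (union_extE hg).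
have rf := r _ (ess_ext_refl hf).
have hu : ri_hom (union_ext f).
  have hD g x w : ess_ext f g -> Dom g x -> Dom g (x ++ w).
    by move=> -[[/right_idealP h _] _ _]; apply: h.
  split.
    apply/right_idealP => x w /union_extD[g [hg gx]].
    by apply: (restriction_Dom (r _ hg)); apply: hD.
  move=> x w y e.
  have [g [hg gx]] : exists g, ess_ext f g /\ Dom g x.
    by apply: union_extD; apply/DomP; exists y.
  rewrite (union_extE hg (hD _ _ _ hg gx)); move: e; rewrite (union_extE hg gx).
  by case: hg => -[_ h] _ _; apply: h.
split=> //; apply/essentialP; split; [exact: hf.1|exact: hu.1|exact: restriction_Dom|].
by move=> x /union_extD[g [[_ _ /essentialP[_ _ _ eg]] /eg]].
Qed.

Lemma max_ess_extP f g : ri_hom f -> max_ess_ext f g <-> g = union_ext f.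
Proof.
move=> hf; have hu := union_ext_ess hf; split=> [[hg m]|->].
  by apply/esym/m => // x gx; rewrite (union_extE hg).
split=> // h hh r; apply/funext => x.
case: (pselect (Dom h x)) => [hx|hx]; first by rewrite (union_extE hh).
case: (pselect (Dom (union_ext f) x)) => [ux|ux]; first by rewrite (r _ ux).
by rewrite (notDom hx) (notDom ux).
Qed.

Lemma max_ess_ext_uniq f g h : ri_hom f -> max_ess_ext f g -> max_ess_ext f h -> g = h.
Proof. by move=> hf /(max_ess_extP _ hf)-> /(max_ess_extP _ hf)->. Qed.

Lemma max_extP f : ri_hom f -> max_ess_ext f (max_ext f).
Proof.
move=> hf; have h : exists g, max_ess_ext f g by exists (union_ext f); apply/max_ess_extP.
exact: (@xgetPex _ f (max_ess_ext f) h).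
Qed.

Lemma max_extE f g : ri_hom f -> max_ess_ext f g -> max_ext f = g.
Proof. by move=> hf; apply: max_ess_ext_uniq => //; apply: max_extP. Qed.

Lemma fin_gen_essential R' R : essential R' R -> fin_gen R' -> fin_gen R.
Proof.
move=> /essentialP[_ hR sub es] [P finP eR'].
exists (R `&` \bigcup_(p in P) ((fun n => take n p) @` `I_(size p).+1)).
  by apply: finite_setIr; apply: bigcup_finite => // p _; exact: finite_image.
apply/seteqP; split=> [x Rx|]; last first.
  by move=> _ [q [Rq _] [w _ <-]]; move/right_idealP: hR; apply.
have [w] := es _ Rx; rewrite eR' => -[p Pp [u _ e]].
case: (leqP (size p) (size x)) => hs.
  exists p; last first.
    exists (drop (size p) x) => //; rewrite -{2}(cat_take_drop (size p) x).
    congr (_ ++ _); have := congr1 (take (size p)) e.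
    by rewrite take_size_cat // takel_cat.
  split; last by exists p => //; exists (size p) => //=; rewrite take_size.
  by apply: sub; rewrite eR'; exists p => //; exists [::] => //; rewrite cats0.
exists x; last by exists [::] => //; rewrite cats0.
split=> //; exists p => //; exists (size x) => /=; first exact: (leq_trans hs).
have := congr1 (take (size x)) e.
by rewrite [RHS]take_size_cat // takel_cat // ltnW.
Qed.

Lemma riHom_max_ext f : riHom f -> riHom (max_ext f).
Proof.
move=> [hf finf]; have [[hm _ em] _] := max_extP hf.
by split=> //; apply: fin_gen_essential em finf.
Qed.

Lemma finite_words n : finite_set [set w : word | size w = n].
Proof.
apply: (sub_finite_set (B := range (fun t : n.-tuple A => tval t))).
  by move=> w /= /eqP sw; exists (Tuple sw).
by apply: finite_image; apply: finite_finset.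
Qed.

Lemma finite_words_le n : finite_set [set w : word | size w <= n].
Proof.
apply: (sub_finite_set (B := \bigcup_(i in `I_n.+1) [set w : word | size w = i])).
  by move=> w /= sw; exists (size w).
by apply: bigcup_finite => // i _; exact: finite_words.
Qed.

Lemma riHom_pcomp g f : riHom g -> riHom f -> riHom (pcomp g f).
Proof.
move=> [hg [Q finQ eQ]] [hf [P finP eP]].
have hgD := hg.1; have hfD := hf.1.
have gfD x : Dom (pcomp g f) x <-> exists2 y, f x = Some y & Dom g y.
  rewrite /Dom /pcomp /=; case: (f x) => [y|] //=; last by split=> // -[].
  by split=> [gy|[_ [<-]]] //; exists y.
have hgf : ri_hom (pcomp g f).
  split=> [|x w z].
    apply/right_idealP => x w /gfD[y e gy]; apply/gfD.
    by exists (y ++ w); [apply: hf.2|move/right_idealP: hgD; apply].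
  rewrite /pcomp; case e: (f x) => [y|] //= gy.
  by rewrite (hf.2 _ w _ e) /=; apply: hg.2.
have [N leN] : exists N, forall q, Q q -> size q <= N.
  move/finite_seqP: finQ => [s eQs]; exists (\max_(q <- s) size q) => q.
  by rewrite eQs /= => qs; apply: leq_bigmax_seq.
split=> //.
exists (Dom (pcomp g f) `&` [set p ++ w | p in P & w in [set w : word | size w <= N]]).
  by apply: finite_setIr; apply: finite_image2 => //; exact: finite_words_le.
apply/seteqP; split=> [x gfx|]; last first.
  by move=> _ [q [Rq _] [w _ <-]]; move/right_idealP: hgf.1; apply.
have [y fx gy] := (gfD _).1 gfx.
have [p Pp [w _ ex]] : gen P x by rewrite -eP; apply/DomP; exists y.
have [z fp] : exists z, f p = Some z.
  by apply/DomP; rewrite eP; exists p => //; exists [::]; rewrite ?cats0.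
have [q Qq [u _ ey]] : gen Q y by rewrite -eQ.
exists (p ++ take N w); last by exists (drop N w) => //; rewrite -catA cat_take_drop.
split; last by exists p => //; exists (take N w) => //=; rewrite size_take_min geq_minl.
apply/gfD; exists (z ++ take N w); first exact: hf.2.
have zw : z ++ w = q ++ u.
  by have := hf.2 _ w _ fp; rewrite ex fx ey => -[->].
rewrite eQ; exists q => //; case: (leqP (size w) N) => sw.
  by exists u => //; rewrite take_oversize.
exists (take (size z + N - size q) u) => //.
have le : size q <= size z + N by apply: leq_trans (leN _ Qq) (leq_addl _ _).
have := congr1 (take (size z + N)) zw; rewrite !take_cat.
rewrite ltnNge leq_addr /= addKn => ->.
by rewrite ltnNge le.
Qed.

Lemma Mk1_riHom m : Mk1 m -> riHom m.
Proof. by move=> [f hf <-]; apply: riHom_max_ext. Qed.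

Lemma Mk1_mulM g f : Mk1 g -> Mk1 f -> Mk1 (mulM g f).
Proof.
by move=> /Mk1_riHom hg /Mk1_riHom hf; exists (pcomp g f) => //; apply: riHom_pcomp.
Qed.

Lemma code_repr_ex m : 0 < #|A| -> Mk1 m -> exists f, code_repr m f.
Proof.
move=> /card_gt0P[a _] Mm; have [hm [P finP eP]] := Mk1_riHom Mm.
have hmD := hm.1.
have [N leN] : exists N, forall p y, P p -> m p = Some y -> size y <= N.
  move/finite_seqP: finP => [s ePs]; exists (\max_(p <- s) size (odflt [::] (m p))).
  move=> p y; rewrite ePs /= => ps e.
  have := @leq_bigmax_seq _ s xpredT (fun p => size (odflt [::] (m p))) p ps isT.
  by rewrite e.
pose f : pfun := fun x => if m x is Some y then if N <= size y then Some y else None else None.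
have fE x y : f x = Some y <-> m x = Some y /\ N <= size y.
  rewrite /f; case: (m x) => [z|]; last by split=> // -[].
  case: ifP => h; first by split=> [[<-]|[]].
  by split=> [|[[<-]]] //; rewrite h.
have hf : ri_hom f.
  have h2 x w y : f x = Some y -> f (x ++ w) = Some (y ++ w).
    move=> /fE[e sy]; apply/fE; split; first exact: hm.2.
    by rewrite size_cat (leq_trans sy) ?leq_addr.
  split=> //; apply/right_idealP => x w /DomP[y e].
  by apply/DomP; exists (y ++ w); apply: h2.
have fin : fin_gen (Dom f).
  exists (Dom f `&` [set p ++ w | p in P & w in [set w : word | size w <= N]]).
    by apply: finite_setIr; apply: finite_image2 => //; exact: finite_words_le.
  apply/seteqP; split=> [x|]; last first.
    by move=> _ [q [Rq _] [w _ <-]]; move/right_idealP: hf.1; apply.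
  move=> /DomP[y /fE[e sy]].
  have [p Pp [w _ ex]] : gen P x by rewrite -eP; apply/DomP; exists y.
  have [z mp] : exists z, m p = Some z.
    by apply/DomP; rewrite eP; exists p => //; exists [::]; rewrite ?cats0.
  exists (p ++ take N w); last by exists (drop N w) => //; rewrite -catA cat_take_drop.
  split; last by exists p => //; exists (take N w) => //=; rewrite size_take_min geq_minl.
  apply/DomP; exists (z ++ take N w); apply/fE; split; first exact: hm.2.
  have yE : y = z ++ w by have := hm.2 _ w _ mp; rewrite ex e => -[].
  move: sy; rewrite yE !size_cat size_take_min /minn.
  by case: ltnP => // _ _; apply: leq_addl.
have fm : ess_ext f m.
  have r : restriction f m by move=> x /DomP[y e]; rewrite e; case/fE: e.
  split=> //; apply/essentialP; split; [exact: hf.1|by []|exact: restriction_Dom|].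
  move=> x /DomP[y e]; exists (nseq N a); apply/DomP; exists (y ++ nseq N a).
  by apply/fE; split; [exact: hm.2|rewrite size_cat size_nseq leq_addl].
exists f; split=> //.
  apply: max_extE => //; split=> // h fh r.
  have [f0 [hf0 _] em] := Mm; have [m0 mm] := max_extP hf0.
  rewrite em in m0 mm; apply: mm => //.
  apply: ess_ext_trans m0 _; have [hh _ /essentialP[_ hD _ eh]] := fh.
  split=> //; apply/essentialP; split=> //; first exact: restriction_Dom.
  move=> x /eh[w fw]; exists w; apply: restriction_Dom fw; by case: fm.
have sz y : imC f y -> size y = N.
  move=> [x]; rewrite /domC (codeE hf.1) => -[fx mx] /[dup] fxy /fE[e sy].
  have [p Pp [w _ ex]] : gen P x by rewrite -eP; apply/DomP; exists y.
  have [z mp] : exists z, m p = Some z.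
    by apply/DomP; rewrite eP; exists p => //; exists [::]; rewrite ?cats0.
  have yE : y = z ++ w by have := hm.2 _ w _ mp; rewrite ex e => -[].
  apply/eqP; rewrite eqn_leq sy andbT.
  case: (lastP w) yE ex => [|w' b] yE ex.
    by rewrite yE cats0; apply: leN mp.
  rewrite leqNgt; apply/negP => lt.
  have : p ++ w' = x.
    apply: mx; last by rewrite -ex -rcons_cat prefix_rcons.
    apply/DomP; exists (z ++ w'); apply/fE; split; first exact: hm.2.
    by move: lt; rewrite yE -rcons_cat size_rcons ltnS.
  by move/(congr1 size); rewrite -ex -rcons_cat size_rcons => /eqP; rewrite ltn_eqF.
move=> x y /sz sx /sz sy; rewrite prefixE sx -sy take_size => /eqP; by [].
Qed.

End Defs.

(* Main.v *)
Require Import Defs.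
From mathcomp Require Import all_boot.
From mathcomp Require Import all_classical.

Local Open Scope classical_set_scope.

(** A finitely generated right ideal R has a threshold N beyond which membership
of x can be read off from any extension of x: if R (x ++ w) and N <= size x then
R x.  Hence passing to an essentially equal restriction with such a domain does not
change the ends of the image, which gives (1) => (2).
For (5) => (6), being a path of maximal length amounts to being the chain of
prefixes of one long word.  For (6) => (1), saturation shows that every long
word of Im psi0 lies in Im phi0; since imC phi0 is a prefix code, phi0 has a
section g that is a right ideal homomorphism on Im phi0, and g after psi0
represents the multiplier: phi0 after (g after psi0) restricts psi0, essentially. *)

(** * Words: prefixes, generated ideals, paths and saturated trees *)

Section Words.
Set Implicit Arguments.
Unset Strict Implicit.
Variable A : finType.
Implicit Types (P R : set (seq A)) (x y z w : seq A).

Lemma prefix_comparable x y z :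
  prefix x z -> prefix y z -> size x <= size y -> prefix x y.
Proof.
rewrite !prefixE => /eqP ex /eqP ey le.
by rewrite -{1}ey take_takel // ex.
Qed.

Lemma prefix_rconsE x z a : prefix x (rcons z a) = (x == rcons z a) || prefix x z.
Proof.
apply/idP/orP => [px|[/eqP->|px]]; last 2 first.
- exact: prefix_refl.
- exact: prefix_trans px (prefix_rcons _ _).
have [le|] := leqP (size x) (size z).
  by right; apply: prefix_comparable px (prefix_rcons _ _) le.
move=> lt; left; move: px; rewrite prefixE take_oversize ?size_rcons //.
by rewrite eq_sym.
Qed.

Lemma genP P z : gen P z <-> exists2 p, P p & prefix p z.
Proof.
split=> [[p Pp [w _ <-]]|[p Pp /prefixP[w ->]]]; exists p => //.
  exact: prefix_prefix.
by exists w.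
Qed.

Lemma sub_gen P x : P x -> gen P x.
Proof. by move=> Px; apply/genP; exists x => //; exact: prefix_refl. Qed.

Lemma right_ideal_cat R x w : right_ideal R -> R x -> R (x ++ w).
Proof. by move=> /right_idealP; apply. Qed.

(** Given finitely many generators, [N] is their maximal length: a generator that is a prefix of
    [x ++ w] is then no longer than [x]. Conversely the words of [R] of length at most [N] generate
    [R], since a longer one has its prefix of length [N] in [R]. *)
Lemma fin_genP R : right_ideal R ->
  fin_gen R <-> exists N, forall x w, R (x ++ w) -> N <= size x -> R x.
Proof.
move=> idR; split=> [[P /finite_seqP[s eP] eR]|[N hN]].
  exists (\max_(p <- s) size p) => x w; rewrite eR.
  move=> /genP[p Pp pxw] le; apply/genP; exists p => //.
  apply: prefix_comparable pxw (prefix_prefix _ _) (leq_trans _ le).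
  by apply: leq_bigmax_seq => //; move: Pp; rewrite eP.
exists (R `&` [set x | size x <= N]).
  by apply: finite_setIr; exact: finite_words_le.
apply/seteqP; split=> [x Rx|x /genP[p [Rp _] /prefixP[w ->]]]; last first.
  exact: right_ideal_cat.
have [le|lt] := leqP (size x) N; first exact: sub_gen.
apply/genP; exists (take N x); last by rewrite -{2}(cat_take_drop N x) prefix_prefix.
have sN : size (take N x) = N by rewrite size_takel // ltnW.
split; last by rewrite /= sN.
by apply: (hN _ (drop N x)); rewrite ?cat_take_drop ?sN.
Qed.

(** The minimal words of [R] occur in every generating set. *)
Lemma finite_code R : right_ideal R -> fin_gen R -> finite_set (code R).
Proof.
move=> idR [P finP eR]; apply: sub_finite_set finP => x.
rewrite codeE // => -[]; rewrite {1}eR => /genP[p Pp px] mx.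
by rewrite -(mx p) // eR; apply: sub_gen.
Qed.

Lemma size_le_ell P : finite_set P -> forall x, P x -> size x <= ell P.
Proof. by move=> finP x Px; apply: leq_bigmax_seq; rewrite ?in_fset_set ?inE. Qed.

(** Replaces a path from the root by its last vertex, so that (5) becomes a statement on the
    prefixes of one word. *)
Lemma path_edge_vertices z p : path (@edge A) [::] p -> last [::] p = z ->
  size p = size z /\ forall x, (x \in [::] :: p) = prefix x z.
Proof.
elim/last_ind: p z => [|p v IH] z /=.
  by move=> _ <-; split=> // x; rewrite prefixs0 inE.
rewrite rcons_path last_rcons => /andP[/IH /(_ erefl)[sp mp] /existsP[a /eqP ev]] <-.
rewrite size_rcons ev size_rcons sp; split=> // x.
by rewrite -rcons_cons mem_rcons inE mp prefix_rconsE.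
Qed.

Lemma path_edge_to z : exists2 p, path (@edge A) [::] p & last [::] p = z.
Proof.
elim/last_ind: z => [|z a [p pp ep]]; first by exists [::].
exists (rcons p (rcons z a)); last by rewrite last_rcons.
by rewrite rcons_path pp ep /=; apply/existsP; exists a.
Qed.

Lemma mkseq_cat (u : nat -> A) n m :
  mkseq u (n + m) = mkseq u n ++ mkseq (fun i => u (n + i)) m.
Proof.
rewrite /mkseq iotaD map_cat add0n; congr (_ ++ _).
by rewrite -{1}(addn0 n) iotaDl -map_comp.
Qed.

Lemma saturated_children (T : set (seq A)) v a : saturated T -> T v -> T (rcons v a) ->
  forall b, T (rcons v b).
Proof.
move=> satT Tv Ta b.
have nz : nb_children T v <> 0.
  by move=> /card0_eq /(_ a); rewrite inE /=; move/asboolPn; case.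
have := cardC [pred a | `[< T (rcons v a) >]].
rewrite -[X in X + _]/(nb_children T v) satT // -[RHS]addn0 => /addnI.
by move=> /card0_eq /(_ b); rewrite !inE => /negbFE/asboolP.
Qed.

(** Read [v] letter by letter from the root [y]. At an inner vertex saturation provides the next
    child, whatever the letter; once a word of [L] is reached, it remains a prefix. *)
Lemma saturated_extend y (L : set (seq A)) v : L `<=` gen [set y] -> L !=set0 ->
  saturated (subtree y L) ->
  subtree y L (y ++ v) \/ exists2 x, L x & prefix x (y ++ v).
Proof.
move=> Ly [x0 Lx0] satL; elim/last_ind: v => [|v a [[pyv [x Lx]]|[x Lx px]]].
- left; rewrite cats0; split; [exact: prefix_refl|exists x0 => //].
  by have /genP[_ ->] := Ly _ Lx0.
- move=> /prefixP[[|b r] ex].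
    right; exists x => //; rewrite ex cats0 -rcons_cat; exact: prefix_rcons.
  left; rewrite -rcons_cat; apply: (@saturated_children _ _ b) => //.
    by split=> //; exists x => //; rewrite ex prefix_prefix.
  split; first by rewrite rcons_cat prefix_prefix.
  by exists x => //; rewrite ex -cat_rcons prefix_prefix.
- right; exists x => //; apply: prefix_trans px _.
  by rewrite -rcons_cat prefix_rcons.
Qed.

End Words.

(** * Right ideal homomorphisms: restrictions, images and sections *)

Section Homs.
Set Implicit Arguments.
Unset Strict Implicit.
Variable A : finType.
Implicit Types f g h : pfun A.

Lemma ess_extP f g : ess_ext f g <-> [/\ ri_hom g, right_ideal (Dom f),
  restriction f g & forall x, Dom g x -> exists w, Dom f (x ++ w)].
Proof.
split=> [[hg r /essentialP[]]//|[hg idf r e]]; split=> //.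
apply/essentialP; split=> //; [exact: hg.1|exact: restriction_Dom].
Qed.

Lemma restriction_some f g x y : restriction f g -> f x = Some y -> g x = Some y.
Proof. by move=> r e; rewrite -r // /Dom /= e. Qed.

Lemma ess_ext_max_ext f : ri_hom f -> ess_ext f (max_ext f).
Proof. by move=> /max_extP[]. Qed.

(** This identifies elements of the monoid: homomorphisms with a common essentially equal
    restriction have the same maximal extension. *)
Lemma max_ext_ess_ext f g : ri_hom f -> ess_ext f g -> max_ext g = max_ext f.
Proof.
move=> hf fg; have hg : ri_hom g by case: fg.
have fm : ess_ext f (max_ext g) by apply: ess_ext_trans fg (ess_ext_max_ext hg).
apply/esym/max_extE => //; split=> // h fh r.
have [_ mg] := max_extP hg; apply: mg => //.
apply/ess_extP; have /ess_extP[hh _ _ eh] := fh; split=> //; first exact: hg.1.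
- move=> x gx; have [_ rg _] := ess_ext_max_ext hg.
  by rewrite rg // r //; apply: restriction_Dom gx.
- by move=> x /eh[w fw]; exists w; apply: restriction_Dom fw; case: fg.
Qed.

Lemma Im_restriction f g : restriction f g -> Im f `<=` Im g.
Proof. by move=> r y [x /(restriction_some r) e]; exists x. Qed.

Lemma Im_pcomp f g : Im (pcomp g f) `<=` Im g.
Proof. by move=> z [x]; rewrite /pcomp; case: (f x) => //= y e; exists y. Qed.

(** Let [N] be the threshold of [Dom f]. After [N] more letters of [u] the argument is long enough
    to lie in [Dom f], because essentiality puts some extension of it there. *)
Lemma ends_Im_ess_ext f g : fin_gen (Dom f) -> ess_ext f g ->
  ends (Im g) `<=` ends (Im f).
Proof.
move=> + /ess_extP[hg idf r eg] => /(fin_genP idf)[N hN] u [n [x gx]].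
pose v := mkseq (fun i => u (n + i)) N.
have gxv : g (x ++ v) = Some (mkseq u (n + N)) by rewrite mkseq_cat; apply: hg.2.
exists (n + N), (x ++ v); rewrite r //.
have [|w] := eg (x ++ v); first by apply/DomP; exists (mkseq u (n + N)).
by move/hN; apply; rewrite size_cat size_mkseq leq_addl.
Qed.

Lemma right_ideal_Im f : ri_hom f -> right_ideal (Im f).
Proof. by move=> [_ hf]; apply/right_idealP => y w [x e]; exists (x ++ w); apply: hf. Qed.

Lemma sub_imC f : imC f `<=` Im f.
Proof. by move=> y [x _ e]; exists x. Qed.

Lemma gen_imC f : ri_hom f -> Im f = gen (imC f).
Proof.
move=> hf; apply/seteqP; split=> [y [x e]|y /genP[c /sub_imC fc /prefixP[w ->]]].
  have [_ eD] := codeP hf.1.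
  have /genP[p Pp /prefixP[w ex]] : gen (code (Dom f)) x.
    by rewrite -eD; apply/DomP; exists y.
  have /DomP[c ec] : Dom f p by rewrite eD; apply: sub_gen.
  apply/genP; exists c; first by exists p.
  by have := hf.2 _ w _ ec; rewrite -ex e => -[->]; apply: prefix_prefix.
by apply: right_ideal_cat => //; apply: right_ideal_Im.
Qed.

Lemma finite_imC f : riHom f -> finite_set (imC f).
Proof.
move=> [hf fin]; apply: (sub_finite_set (B := (odflt [::] \o f) @` domC f)).
  by move=> y [x dx e]; exists x => //=; rewrite e.
by apply: finite_image; apply: finite_code => //; exact: hf.1.
Qed.

(* s c ++ v is well defined on Im f because y = c ++ v determines c in a prefix
   code; f itself need not be injective, so preimages s c are chosen. *)
Lemma section_ex f : riHom f -> prefix_code (imC f) ->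
  exists g, [/\ riHom g, Dom g = Im f & forall y, Im f y -> pcomp f g y = Some y].
Proof.
move=> /[dup] rf [hf _] pc.
have /choice[s sP] c : exists x, imC f c -> f x = Some c.
  by have [[x _ e]|] := pselect (imC f c); [exists x|exists [::]].
have /choice[g gP] y : exists o,
    (forall c v, imC f c -> y = c ++ v -> o = Some (s c ++ v)) /\
    (~ gen (imC f) y -> o = None).
  have [/genP[c fc /prefixP[v e]]|ny] := pselect (gen (imC f) y); last first.
    by exists None; split=> // c v fc e; case: ny; apply/genP; exists c; rewrite ?e ?prefix_prefix.
  exists (Some (s c ++ v)); split; last first.
    by case; apply/genP; exists c; rewrite ?e ?prefix_prefix.
  move=> d u fd e'; have ed : d = c.
    have pd : prefix d y by rewrite e' prefix_prefix.
    have pcy : prefix c y by rewrite e prefix_prefix.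
    have [le|/ltnW le] := leqP (size d) (size c).
      by apply: pc => //; apply: prefix_comparable pd pcy le.
    by apply/esym/pc => //; apply: prefix_comparable pcy pd le.
  by move: e' e; rewrite ed => -> /eqP; rewrite eqseq_cat // => /andP[_ /eqP->].
have gE c v : imC f c -> g (c ++ v) = Some (s c ++ v).
  by move=> fc; apply: (gP _).1.
have Dg : Dom g = Im f.
  rewrite gen_imC //; apply/seteqP; split=> [y gy|y /genP[c fc /prefixP[v ->]]].
    by apply: contrapT => /(gP y).2.
  by rewrite /Dom /= gE.
have hg : ri_hom g.
  split; first by rewrite Dg; exact: right_ideal_Im.
  move=> y w x gy; have : Dom g y by apply/DomP; exists x.
  rewrite Dg gen_imC // => /genP[c fc /prefixP[v ey]].
  by move: gy; rewrite ey -catA !gE // => -[<-]; rewrite catA.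
exists g; split=> //.
- split=> //; rewrite Dg; exists (imC f); [exact: finite_imC|exact: gen_imC].
- move=> y; rewrite gen_imC // => /genP[c fc /prefixP[v ->]].
  by rewrite /pcomp gE //=; apply: hf.2; apply: sP.
Qed.

End Homs.

(** * The equivalence, proved as a cycle of implications *)

Theorem theorem2p1 (A : finType) (cardA : 2 <= #|A|)
    (psi phi : pfun A) (Mpsi : Mk1 psi) (Mphi : Mk1 phi)
    (psi0 phi0 : pfun A)
    (psi0P : code_repr psi psi0) (phi0P : code_repr phi phi0) :
  [<-> leR psi phi;
       ends (Im psi) `<=` ends (Im phi);
       forall R : set (seq A),
         right_ideal R -> intersects R (Im psi) -> intersects R (Im phi);
       forall w : seq A,
         intersects (gen [set w]) (Im psi) -> intersects (gen [set w]) (Im phi);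
       forall p : seq (seq A),
         path (@edge A) [::] p ->
         size p = maxn (ell (imC phi0)) (ell (imC psi0)) ->
         intersects [set` [::] :: p] (imC psi0) -> intersects [set` [::] :: p] (imC phi0);
       forall y : seq A, imC psi0 y ->
         (exists2 x, imC phi0 x & prefix x y) \/
         let L := gen [set y] `&` imC phi0 in
         L !=set0 /\ saturated (subtree y L)].
Proof.
have [a0 _] : exists a : A, a \in A by apply/card_gt0P; exact: ltnW.
have [rpsi0 epsi cpsi] := psi0P; have [rphi0 ephi cphi] := phi0P.
have hpsi0 := rpsi0.1; have hphi0 := rphi0.1.
have xpsi : ess_ext psi0 psi by rewrite -epsi; apply: ess_ext_max_ext.
have xphi : ess_ext phi0 phi by rewrite -ephi; apply: ess_ext_max_ext.
have hpsi : ri_hom psi by case: xpsi.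
have hphi : ri_hom phi by case: xphi.
have size_phi0 := size_le_ell (finite_imC rphi0).
have size_psi0 := size_le_ell (finite_imC rpsi0).
tfae.
- move=> [alpha Ma ->] u.
  have rc : riHom (pcomp phi alpha) by apply: riHom_pcomp; apply: Mk1_riHom.
  move/(ends_Im_ess_ext rc.2 (ess_ext_max_ext rc.1)) => -[n].
  by move/Im_pcomp; exists n.
(* The infinite word [u] is [z] followed by [a0] forever, hence an end of [Im psi]. *)
- move=> sub R idR [z [Rz pz]]; pose u := nth a0 z.
  have uz : mkseq u (size z) = z by apply: mkseq_nth.
  have [n phin] : ends (Im phi) u by apply: sub; exists (size z); rewrite uz.
  (* This prefix of [u] extends both [z], which lies in [R], and [mkseq u n], which lies in
     [Im phi]. *)
  exists (mkseq u (size z + n)); split; last first.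
    by rewrite addnC mkseq_cat; apply: right_ideal_cat => //; apply: right_ideal_Im.
  by rewrite mkseq_cat uz; apply: right_ideal_cat.
- by move=> h w; apply: h; exact: right_ideal_gen.
- move=> h p pp sp [y [/= yp fy]].
  have [sz mz] := path_edge_vertices pp erefl; set z := last [::] p in sz mz.
  have : intersects (gen [set z]) (Im phi).
    apply: h; exists z; split; first exact: sub_gen.
    have /prefixP[w ->] : prefix y z by rewrite -mz.
    apply: right_ideal_cat; first exact: right_ideal_Im.
    by case: xpsi => _ r _; apply: (Im_restriction r); apply: sub_imC.
  move=> [_ [/genP[_ -> /prefixP[u ->]] [x ex]]].
  (* Extending by [w] passes from [Im phi] to [Im phi0]. The word [q] of [imC phi0] found there is
     no longer than [z], whose length is the maximum in (5), so [q] is a vertex of the path. *)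
  have /ess_extP[_ _ r eD] := xphi.
  have [w /DomP[v ev]] : exists w, Dom phi0 (x ++ w).
    by apply: eD; apply/DomP; exists (z ++ u).
  have : gen (imC phi0) ((z ++ u) ++ w).
    rewrite -gen_imC //; exists (x ++ w).
    by have := restriction_some r ev; rewrite (hphi.2 _ _ _ ex) ev.
  rewrite -catA => /genP[q fq pq]; exists q; split=> //=; rewrite mz.
  apply: prefix_comparable pq (prefix_prefix _ _) _.
  by rewrite -sz sp leq_max size_phi0.
- move=> h.
  set M := maxn _ _ in h.
  (* Pad v to length M and apply h to the chain of prefixes of the result. *)
  have {h} meet y v : imC psi0 y -> prefix y v -> size v <= M ->
      exists2 q, imC phi0 q & prefix q v \/ prefix v q.
    move=> fy yv sv; pose z := v ++ nseq (M - size v) a0.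
    have [p pp /(path_edge_vertices pp)[sp mp]] := path_edge_to z.
    have [||q [/= qp fq]] := h p pp.
    + by rewrite sp size_cat size_nseq subnKC.
    + exists y; split=> //=; rewrite mp; exact: prefix_trans yv (prefix_prefix _ _).
    + rewrite mp in qp; have vz : prefix v z := prefix_prefix _ _.
      exists q => //; have [le|/ltnW le] := leqP (size q) (size v).
        by left; apply: prefix_comparable qp vz le.
      by right; apply: prefix_comparable vz qp le.
  move=> y fy; have [|np] := pselect (exists2 x, imC phi0 x & prefix x y); first by left.
  right; split.
    have [|q fq [pq|pq]] := meet _ _ fy (prefix_refl y).
    + by rewrite leq_max size_psi0 ?orbT.
    + by case: np; exists q.
    + by exists q; split=> //; apply/genP; exists y.
  (* One child of [v] has a leaf [x] below it, so [v] is strictly shorter than [x]. Hence each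
     [rcons v b] has length at most [M] and [meet] applies to it. *)
  move=> v [yv _] /eqP; rewrite -lt0n => /card_gt0P[a /asboolP[yva [x [_ fx] vax]]].
  apply: eq_card => b; rewrite !inE; apply/asboolP.
  have yvb : prefix y (rcons v b) by apply: prefix_trans yv (prefix_rcons _ _).
  have vx : size v < size x by have := size_prefix vax; rewrite size_rcons.
  have [|q fq [|vbq]] := meet _ _ fy yvb.
  + by rewrite size_rcons (leq_trans vx) // leq_max size_phi0.
  + rewrite prefix_rconsE => /orP[/eqP eq|qv].
      rewrite eq in fq; split=> //; exists (rcons v b); last exact: prefix_refl.
      by split=> //; apply/genP; exists y.
    (* A [q] that is a prefix of [v] would be a proper prefix of [x], against [cphi]. *)
    have qx : q = x.
      apply: cphi => //; apply: prefix_trans qv (prefix_trans (prefix_rcons v a) vax).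
    by have := size_prefix qv; rewrite qx leqNgt vx.
  + split=> //; exists q => //; split=> //; apply/genP; exists y => //.
    exact: prefix_trans yvb vbq.
- move=> h.
  have [g [rg Dg gK]] := section_ex rphi0 cphi.
  have /(fin_genP (right_ideal_Im hphi0))[N hN] : fin_gen (Im phi0) by rewrite -Dg; case: rg.
  have long w : Im psi0 w -> N <= size w -> Im phi0 w.
    rewrite gen_imC // => /genP[y fy /prefixP[v ->]] sw.
    have [[x fx xy]|[L0 satL]] := h y fy.
      by rewrite gen_imC //; apply/genP; exists x => //; apply: prefix_trans xy (prefix_prefix _ _).
    (* Either [y ++ v] is a prefix of a word of [imC phi0], and the threshold [N] puts it in
       [Im phi0], or it already has a prefix in [imC phi0]. *)
    have [|[_ [x [_ fx] /prefixP[r ex]]]|[x [_ fx] px]] := @saturated_extend _ y (gen [set y] `&` imC phi0) v _ L0 satL.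
    + by move=> x [].
    + by apply: (hN _ r) => //; rewrite -ex; apply: sub_imC.
    + by rewrite gen_imC //; apply/genP; exists x.
  have ra0 : riHom (pcomp g psi0) by apply: riHom_pcomp.
  set alpha0 := pcomp g psi0 in ra0.
  have xalpha := ess_ext_max_ext ra0.1; set alpha := max_ext alpha0 in xalpha.
  have Malpha : Mk1 alpha by exists alpha0.
  exists alpha => //.
  have rb : riHom (pcomp phi0 alpha0) by apply: riHom_pcomp.
  have bE x w : psi0 x = Some w -> Im phi0 w -> pcomp phi0 alpha0 x = Some w.
    by move=> e fw; have := gK _ fw; rewrite /alpha0 /pcomp e.
  (* [pcomp phi0 alpha0] serves as common essentially equal restriction of [psi0] and
     [pcomp phi alpha]. For [psi0], any [N] further letters make the value long enough for
     [long]. *)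
  have bpsi : ess_ext (pcomp phi0 alpha0) psi0.
    apply/ess_extP; split=> //; first exact: rb.1.1.
      move=> x; rewrite /Dom /= {1}/pcomp /alpha0 {1}/pcomp.
      case e: (psi0 x) => [w|] //=; case ew: (g w) => [t|] // _.
      by apply: bE => //; rewrite -Dg; apply/DomP; exists t.
    move=> x /DomP[w e]; exists (nseq N a0); apply/DomP; exists (w ++ nseq N a0).
    have e' := hpsi0.2 _ (nseq N a0) _ e; apply: bE => //; apply: long.
      by exists (x ++ nseq N a0).
    by rewrite size_cat size_nseq leq_addl.
  have bphi : ess_ext (pcomp phi0 alpha0) (pcomp phi alpha).
    have [_ ralpha _] := xalpha; have [_ rphi _] := xphi.
    apply/ess_extP; split; last 2 first.
    + move=> x /DomP[z]; rewrite {1}/pcomp; case e: (alpha0 x) => [y|] //= ez.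
      rewrite /pcomp e (restriction_some ralpha e) /=.
      by rewrite ez (restriction_some rphi ez).
    + move=> x /DomP[z]; rewrite {1}/pcomp; case e: (alpha x) => [y|] //= ez.
      (* First [w] brings the argument into [Dom alpha0], then [t] brings the value into
         [Dom phi0]. *)
      have /ess_extP[halpha idalpha0 _ ea] := xalpha; have /ess_extP[_ _ _ ep] := xphi.
      have [w xw] : exists w, Dom alpha0 (x ++ w) by apply: ea; apply/DomP; exists y.
      have [t yt] : exists t, Dom phi0 ((y ++ w) ++ t).
        by apply: ep; apply/DomP; exists (z ++ w); apply: hphi.2.
      exists (w ++ t); rewrite /Dom /= /pcomp catA.
      have -> : alpha0 ((x ++ w) ++ t) = Some ((y ++ w) ++ t).
        rewrite ralpha; last exact: right_ideal_cat idalpha0 xw.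
        by do 2 apply: halpha.2.
      exact: yt.
    + by have [] := riHom_pcomp (Mk1_riHom Mphi) (Mk1_riHom Malpha).
    + exact: rb.1.1.
  by rewrite -epsi /mulM (max_ext_ess_ext rb.1 bpsi) (max_ext_ess_ext rb.1 bphi).
Qed.
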